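(* Let $\mathcal{P}\in\mathcal{Q}_n$ be an irreducible, tridiagonal sign pattern with a $0$-diagonal. If $\mathcal{P}$ is consistent, then every $A\in\mathcal{Q}(\mathcal{P})$ has at most one zero eigenvalue, i.e., $0$ is an eigenvalue of $A$ of algebraic multiplicity at most $1$.
   Context: A sign pattern is a matrix with entries in $\{+,-,0\}$; $\mathcal{Q}_n$ is the set of $n\times n$ sign patterns; $\mathcal{Q}(\mathcal{P})$ is the set of real matrices whose entries have the signs prescribed by $\mathcal{P}=[p_{ij}]$. $\mathcal{P}$ is tridiagonal if $p_{ij}=0$ whenever $|i-j|>1$; irreducible tridiagonal means $p_{i,i+1}\ne0$ and $p_{i+1,i}\neq0$ for all $i$; $0$-diagonal means $p_{ii}=0$ for all $i$. $\mathcal{P}$ is consistent if there is $k$ such that every $A\in\mathcal{Q}(\mathcal{P})$ has exactly $k$ real eigenvalues (with algebraic multiplicity). *)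

(* Defs.v *)
From mathcomp Require Import all_boot all_order all_algebra.
From mathcomp Require Import reals polyrcf.

Set Implicit Arguments.
Unset Strict Implicit.
Unset Printing Implicit Defensive.

Import Order.TTheory GRing.Theory Num.Theory.
Local Open Scope ring_scope.

Inductive sign := SPos | SNeg | SZero.

Notation signpattern n := 'M[sign]_n (only parsing).

Definition has_sign (R : realType) (s : sign) (x : R) : Prop :=
  match s with
  | SPos => 0 < x
  | SNeg => x < 0
  | SZero => x = 0
  end.

Definition qual_class (R : realType) (n : nat) (P : signpattern n)
    (A : 'M[R]_n) : Prop :=
  forall i j : 'I_n, has_sign (P i j) (A i j).

Definition tridiagonal (n : nat) (P : signpattern n) : Prop :=
  forall i j : 'I_n, (i.+1 < j)%N || (j.+1 < i)%N -> P i j = SZero.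

Definition irreducible_tridiagonal (n : nat) (P : signpattern n) : Prop :=
  tridiagonal P /\
  forall i j : 'I_n, (j : nat) = i.+1 -> P i j <> SZero /\ P j i <> SZero.

Definition zero_diagonal (n : nat) (P : signpattern n) : Prop :=
  forall i : 'I_n, P i i = SZero.

Definition alg_mult (R : realType) (n : nat) (A : 'M[R]_n) (a : R) : nat :=
  mup a (char_poly A).

(* [rootsR p] lists the distinct roots of [p] in R, so that the multiplicities
   come only from [alg_mult]. *)
Definition num_real_eigenvalues (R : realType) (n : nat) (A : 'M[R]_n) : nat :=
  (\sum_(a <- rootsR (char_poly A)) alg_mult A a)%N.

Definition consistent (R : realType) (n : nat) (P : signpattern n) : Prop :=
  exists k : nat,
    forall A : 'M[R]_n, qual_class P A -> num_real_eigenvalues A = k.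

Lemma mem_rootsR_char_poly (R : realType) (n : nat) (A : 'M[R]_n) (a : R) :
  (a \in rootsR (char_poly A)) = eigenvalue A a.
Proof.
rewrite eigenvalue_root_char.
by rewrite -(roots_on_rootsR (monic_neq0 (char_poly_monic A))) in_itv.
Qed.

Lemma uniq_rootsR_char_poly (R : realType) (n : nat) (A : 'M[R]_n) :
  uniq (rootsR (char_poly A)).
Proof. exact: uniq_roots. Qed.

Lemma alg_mult_gt0 (R : realType) (n : nat) (A : 'M[R]_n) (a : R) :
  (0 < alg_mult A a)%N = eigenvalue A a.
Proof.
rewrite /alg_mult -XsubC_dvd ?monic_neq0 ?char_poly_monic//.
by rewrite dvdp_XsubCl eigenvalue_root_char.
Qed.

(* Main.v *)
(* The signature matrix [diag((-1)^i)] conjugates [A] to [- A], so the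
   characteristic polynomial [p] is even or odd. For even [n] its constant
   coefficient [\det A] is nonzero. For odd [n], if [p`_1 != 0] then [p / 'X] is
   even and monic, and the sign of [p`_1] is determined by the number of real
   roots of [p] modulo 4; by consistency, it is then the same for all such
   matrices of the class. If [A] had [p`_1 = 0], multiplying its first row by
   [t > 0] would give [p`_1 = (1 - t) * c], where [c] is, up to sign, the
   determinant of [A] with its first row and column removed. That matrix has
   even size, so [c != 0], and [t = 2], [t = 1/2] yield opposite signs. *)
Require Import Defs.
From mathcomp Require Import all_boot all_order all_algebra.
From mathcomp Require Import reals.
From mathcomp Require Import polyrcf ring lra zify.

Set Implicit Arguments.
Unset Strict Implicit.
Unset Printing Implicit Defensive.

Import Order.TTheory GRing.Theory Num.Theory.
Local Open Scope ring_scope.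

(** As [q] has no root, [mup a p] counts the occurrences of [a] in [l]. After exchanging the sums,
    each entry of [l] contributes 1, since [rootsR p] lists it exactly once. *)
Lemma sum_mup_rootsR (R : rcfType) (q : {poly R}) (l : seq R) :
    (forall x, ~~ root q x) ->
  let p := q * \prod_(z <- l) ('X - z%:P) in
  (\sum_(a <- rootsR p) mup a p)%N = size l.
Proof.
move=> qN p; have q0 : q != 0 by apply: contraNneq (qN 0) => ->; exact: root0.
have p0 : p != 0.
  by rewrite mulf_neq0 // monic_neq0 // monic_prod_XsubC.
rewrite (eq_bigr (fun a => count_mem a l)); last first.
  by move=> a _; rewrite mupMr ?qN // mu_prod_XsubC.
under eq_bigr do rewrite -sum1_count big_mkcond /=.
rewrite exchange_big /= -sum1_size; apply: eq_big_seq => z zl.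
rewrite -big_mkcond /= (eq_bigl (pred1 z)) => [|a]; last by rewrite eq_sym.
rewrite sum1_count count_uniq_mem ?uniq_roots //.
rewrite -(roots_on_rootsR p0) in_itv /= rootM root_prod_XsubC zl.
by rewrite orbT.
Qed.

(** Without roots, [p] keeps on [[x, +oo[] the sign of its leading coefficient 1. *)
Lemma monic_noroot_gt0 (R : rcfType) (p : {poly R}) (x : R) :
  p \is monic -> (forall y, ~~ root p y) -> 0 < p.[x].
Proof.
move=> pm pN; rewrite -sgr_gt0 (@sgp_pinftyP _ x) //.
  by rewrite /sgp_pinfty (monicP pm) sgr1.
by rewrite in_itv /= lexx.
Qed.

(* Nonzero roots of an even polynomial come in pairs [a], [- a], and dividing
   by ['X^2 - a^2] flips the sign of the constant coefficient. *)
Lemma even_monic_factor (R : rcfType) (s : {poly R}) :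
    s \is monic -> s \Po - 'X = s -> s.[0] != 0 ->
  exists l q, [/\ s = q * \prod_(z <- l) ('X - z%:P),
    forall x, ~~ root q x & Num.sg s.[0] = (-1) ^+ (size l)./2].
Proof.
elim: {s}_.+1 {-2}s (ltnSn (size s)) => // n IHn s; rewrite ltnS => sn sm sE s0.
case rs : (rootsR s) => [|a r].
  have sN x : ~~ root s x.
    have := roots_on_rootsR (monic_neq0 sm) x.
    by rewrite rs in_nil in_itv /= => ->.
  exists [::], s; split => //; first by rewrite big_nil mulr1.
  by rewrite expr0 gtr0_sg // monic_noroot_gt0.
have ra : root s a.
  have := roots_on_rootsR (monic_neq0 sm) a.
  by rewrite rs mem_head in_itv.
have a0 : a != 0 by apply: contraNneq s0 => a0; rewrite a0 in ra.
have /factor_theorem[u su] := ra.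
have : root s (- a) by rewrite -sE root_comp !hornerE opprK.
(* Since [a != 0], the root [- a] differs from [a] and so must be a root of the cofactor [u]. *)
rewrite [in root s _]su rootM root_XsubC => /orP[|/eqP]; last by move=> Na; case/eqP: a0; lra.
move=> /factor_theorem[t ut]; rewrite ut in su.
have st : s = t * (('X - (- a)%:P) * ('X - a%:P)).
  by rewrite su mulrA.
have dm : ('X - (- a)%:P) * ('X - a%:P) \is monic.
  by rewrite monicMl monicXsubC.
have tm : t \is monic by rewrite -(monicMr _ dm) -st.
have tE : t \Po - 'X = t.
  apply: (mulIf (monic_neq0 dm)); rewrite -st -[RHS]sE {1}st !rmorphM /=.
  congr (_ * _); rewrite !rmorphB /= comp_polyX !comp_polyC polyCN !opprK.
  by rewrite mulrC -mulrNN opprB opprD [a%:P - _]addrC.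
have s0E : s.[0] = - (a ^+ 2) * t.[0].
  by rewrite st !hornerM !hornerXsubC; ring.
have t0 : t.[0] != 0 by apply: contraNneq s0; rewrite s0E => ->; rewrite mulr0.
have tn : (size t < n)%N.
  apply: leq_trans sn; rewrite st size_Mmonic ?monic_neq0 //.
  rewrite size_Mmonic ?polyXsubC_eq0 ?monicXsubC // !size_XsubC.
  by rewrite (_ : (2 + 2).-1 = 3)%N // !addnS addn0 /= ltnW.
have [l [q [tq qN tsg]]] := IHn _ tn tm tE t0.
exists [:: - a, a & l], q; split => //.
  by rewrite 2!big_cons st {1}tq; ring.
rewrite s0E sgrM tsg sgrN gtr0_sg ?exprS ?mulr1 //.
by rewrite -expr2 exprn_even_gt0 ?a0 ?orbT.
Qed.

(** If [v *m A = 0], column [k] relates only [v_(k-1)] and [v_(k+1)]. Indices start at 0: column 0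
    kills [v_1], and the odd entries vanish going up; column [n - 1], which is odd, kills [v_(n-2)],
    and the even entries vanish going down. *)
Lemma det_neq0_tridiagonal (F : fieldType) (n : nat) (A : 'M[F]_n) :
    ~~ odd n ->
    (forall i j : 'I_n, (i.+1 < j)%N || (j.+1 < i)%N -> A i j = 0) ->
    (forall i, A i i = 0) ->
    (forall i j : 'I_n, (j : nat) = i.+1 -> A i j != 0 /\ A j i != 0) ->
  \det A != 0.
Proof.
move=> nE At Ad Aa; apply/negP => /det0P[v v0 vA]; case/negP: v0; apply/eqP.
have col k : \sum_j v 0 j * A j k = 0.
  by have /matrixP/(_ 0 k) := vA; rewrite !mxE.
have isolate (k i : 'I_n) : (k = i.+1 :> nat \/ i = k.+1 :> nat) ->
    (forall j : 'I_n, j != i -> k = j.+1 :> nat \/ j = k.+1 :> nat ->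
      v 0 j = 0) -> v 0 i = 0.
  move=> ki vj.
  have := col k; rewrite (bigD1 i) //= big1 ?addr0 => [/eqP|j ji].
    rewrite mulf_eq0 => /orP[/eqP //|/eqP Aik].
    by case: ki => /Aa[/eqP ? /eqP ?].
  have [->|jk] := eqVneq j k; first by rewrite Ad mulr0.
  have [/At -> |] := boolP ((j.+1 < k)%N || (k.+1 < j)%N); first by rewrite mulr0.
  move=> jk'; rewrite (vj _ ji) ?mul0r //.
  have : (j : nat) != k by []. lia.
have vodd m (i : 'I_n) : (i <= m)%N -> odd i -> v 0 i = 0.
  elim: m i => [|m IHm] i im io; first by move: im io; case: (i : nat).
  have i0 : (i.-1 < n)%N by have := ltn_ord i; lia.
  apply: (isolate (Ordinal i0)) => /=; first by lia.
  move=> j; rewrite -val_eqE /= => ji ij; apply: IHm; lia.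
have veven m (i : 'I_n) : (n <= i + m)%N -> ~~ odd i -> v 0 i = 0.
  elim: m i => [|m IHm] i im io; first by have := ltn_ord i; lia.
  (* Here the parity of [n] matters: an even [i < n] is not the last index. *)
  have i0 : (i.+1 < n)%N by have := ltn_ord i; lia.
  apply: (isolate (Ordinal i0)) => /=; first by lia.
  move=> j; rewrite -val_eqE /= => ji ij; apply: IHm; lia.
apply/rowP => i; rewrite mxE; case: (boolP (odd i)) => io.
  exact: (vodd i).
by apply: (veven n) => //; rewrite leq_addl.
Qed.

(* Conjugation by [diag((-1)^i)] maps [A] to [- A]. *)
Lemma char_poly_bipartite (F : fieldType) (n : nat) (A : 'M[F]_n) :
    (forall i j : 'I_n, odd i = odd j -> A i j = 0) ->
  char_poly A \Po - 'X = (-1) ^+ n * char_poly A.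
Proof.
move=> A0; pose D : 'M[{poly F}]_n := diag_mx (\row_i (-1) ^+ i).
have D2 : \det D * \det D = 1.
  rewrite -expr2 det_diag -prodrXl big1 // => i _.
  by rewrite mxE -exprM mulnC exprM sqrrN expr1n expr1n.
(* Since [\det D] squares to 1, it suffices to compare entries of [char_poly_mx A] at [- 'X] with
   those of [D *m (- char_poly_mx A) *m D]. *)
rewrite /char_poly -detZ -(@det_map_mx _ _ (comp_poly (- 'X))).
rewrite -[RHS]mulr1 -[X in _ = _ * X]D2 mulrCA mulrA -!det_mulmx; congr (\det _).
apply/matrixP => i j; rewrite mul_mx_diag mul_diag_mx !mxE /=.
rewrite comp_polyB comp_polyC rmorphMn /= comp_polyX.
have [<-|ij] := eqVneq i j.
  rewrite A0 // !mulr1n subr0 !subr0.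
  rewrite mulN1r mulrN mulNr mulrAC -expr2 -exprM mulnC exprM sqrrN !expr1n.
  by rewrite mul1r.
rewrite mulr0n !sub0r mulN1r opprK.
have [/A0 ->|] := eqVneq (odd i) (odd j); first by rewrite !rmorph0; ring.
rewrite -[_ ^+ i]signr_odd -[_ ^+ j]signr_odd.
by case: (odd i); case: (odd j) => //= _; rewrite ?expr0 ?expr1; ring.
Qed.

Lemma odd_monic_count (R : rcfType) (p : {poly R}) :
    p \is monic -> p \Po - 'X = - p -> p`_1 != 0 ->
  exists2 m, (\sum_(a <- rootsR p) mup a p)%N = m.+1 &
    Num.sg p`_1 = (-1) ^+ m./2.
Proof.
move=> pm pE p1.
have : root p 0.
  have := congr1 (horner^~ 0) pE; rewrite horner_comp !hornerE oppr0 => h.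
  by apply/rootP; lra.
move=> /factor_theorem[s]; rewrite subr0 => ps.
have sm : s \is monic by rewrite -(monicMr _ (monicX R)) -ps.
have sE : s \Po - 'X = s.
  apply: (mulIf (_ : 'X != 0)); first by rewrite polyX_eq0.
  apply: oppr_inj; rewrite -[in RHS]ps -pE ps rmorphM /= comp_polyX.
  by rewrite mulrN.
have p1E : p`_1 = s.[0] by rewrite ps coefMX horner_coef0.
rewrite p1E in p1 *.
have [l [q [sq qN ->]]] := even_monic_factor sm sE p1.
exists (size l) => //.
suff -> : p = q * \prod_(z <- 0 :: l) ('X - z%:P) by rewrite sum_mup_rootsR.
by rewrite ps sq big_cons subr0 mulrAC mulrA.
Qed.

(** Row [i0] of the new characteristic matrix is [t] times the old row plus [1 - t] times the row
    with ['X] at [i0] and 0 elsewhere; the determinant is linear in that row. *)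
Lemma char_poly_scale_row (F : fieldType) (n : nat) (A : 'M[F]_n) (i0 : 'I_n)
    (t : F) :
  char_poly (\matrix_(i, j) ((if i == i0 then t else 1) * A i j)) =
  t%:P * char_poly A + (1 - t)%:P * ('X * char_poly (row' i0 (col' i0 A))).
Proof.
pose B := \matrix_(i, j) (if i == i0 then 'X *+ (i == j) else char_poly_mx A i j).
have -> : 'X * char_poly (row' i0 (col' i0 A)) = \det B.
  rewrite (expand_det_row _ i0) (bigD1 i0) //= big1 => [|j ji].
    rewrite addr0 !mxE eqxx mulr1n /cofactor addnn -signr_odd odd_double mul1r.
    congr ('X * \det _); apply/matrixP => i j.
    by rewrite !mxE (inj_eq lift_inj) [lift _ _ == i0]eq_sym (negbTE (neq_lift _ _)).
  by rewrite !mxE eqxx eq_sym (negbTE ji) mulr0n mul0r.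
apply: (determinant_multilinear (i0 := i0)); apply/matrixP => i j; rewrite !mxE.
- rewrite eqxx !polyCM polyCB; case: (i0 == j); rewrite ?mulr1n ?mulr0n; ring.
- by rewrite [lift _ _ == i0]eq_sym (negbTE (neq_lift _ _)) mul1r.
- by rewrite [lift _ _ == i0]eq_sym (negbTE (neq_lift _ _)) mul1r.
Qed.

Theorem theorem3p8 (R : realType) (n : nat) (P : signpattern n)
    (hirr : irreducible_tridiagonal P) (hdiag : zero_diagonal P)
    (hcons : consistent R P) :
  forall A : 'M[R]_n, qual_class P A -> (alg_mult A 0 <= 1)%N.
Proof.
move=> A AP; case: hirr => Ptri Padj; case: hcons => k hk.
have Q0 B i j : qual_class (R := R) P B -> P i j = SZero -> B i j = 0.
  by move=> /(_ i j) + Pij; rewrite Pij.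
have Qn0 B i j : qual_class (R := R) P B -> P i j <> SZero -> B i j != 0.
  by move=> /(_ i j); case: (P i j) => //= [/lt0r_neq0|/ltr0_neq0].
have At (i j : 'I_n) : (i.+1 < j)%N || (j.+1 < i)%N -> A i j = 0.
  by move=> /Ptri /(Q0 _ _ _ AP).
have Ad i : A i i = 0 by apply: (Q0 _ _ _ AP).
have Aa (i j : 'I_n) : (j : nat) = i.+1 -> A i j != 0 /\ A j i != 0.
  by move=> /Padj[? ?]; split; apply: (Qn0 _ _ _ AP).
have pm := char_poly_monic A; have p0 := monic_neq0 pm.
have [nO|nE] := boolP (odd n); last first.
  rewrite /alg_mult mupNroot // /root horner_coef0 char_poly_det.
  by rewrite mulf_neq0 ?signr_eq0 // det_neq0_tridiagonal.
(* A multiplicity above 1 means that ['X^2] divides the characteristic polynomial. *)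
rewrite /alg_mult mup_leq // subr0; apply/negP => X2p.
have pA1 : (char_poly A)`_1 = 0.
  by move: X2p => /dvdpP[q ->]; rewrite coefMXn.
have n0 : (0 < n)%N by case: (n) nO.
pose i0 := Ordinal n0; pose c := \det (row' i0 (col' i0 A)).
have lift0E (i : 'I_n.-1) : lift i0 i = i.+1 :> nat by [].
have c0 : c != 0.
  apply: det_neq0_tridiagonal; first by case: (n) nO.
  - move=> i j ij; rewrite !mxE; apply: At; rewrite !lift0E.
    by rewrite !ltnS.
  - by move=> i; rewrite !mxE.
  - by move=> i j ij; rewrite !mxE; apply: Aa; rewrite !lift0E ij.
pose B t : 'M[R]_n := \matrix_(i, j) ((if i == i0 then t else 1) * A i j).
have BP t : 0 < t -> qual_class P (B t).
  move=> t0 i j; have := AP i j; rewrite mxE.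
  have : 0 < (if i == i0 then t else 1) by case: ifP.
  by case: (P i j) => /= u0; rewrite ?(pmulr_rgt0 _ u0) ?(pmulr_rlt0 _ u0) //
    => ->; rewrite mulr0.
have B1 t : (char_poly (B t))`_1 = (1 - t) * ((-1) ^+ n.-1 * c).
  by rewrite char_poly_scale_row coefD !coefCM coefXM pA1 mulr0 add0r char_poly_det.
(* The condition [t != 1] keeps the linear coefficient nonzero; [k = m.+1] makes [m] independent of
   [t]. *)
have Bcount t : 0 < t -> t != 1 ->
    exists2 m, k = m.+1 & Num.sg (char_poly (B t))`_1 = (-1) ^+ m./2.
  move=> t0 t1; rewrite -(hk _ (BP _ t0)); apply: odd_monic_count.
  - exact: char_poly_monic.
  - rewrite char_poly_bipartite; first by rewrite -signr_odd nO mulN1r.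
    move=> i j ij; rewrite mxE.
    have [->|nij] := eqVneq i j; first by rewrite Ad mulr0.
    rewrite At ?mulr0 //; have : (i : nat) != j by []. lia.
  - by rewrite B1 !mulf_neq0 ?signr_eq0 // subr_eq0 eq_sym.
have [||m km Bm] := Bcount 2; [lra|lra|].
have [||m' km' Bm'] := Bcount 2^-1; [lra|lra|].
have mm' : m = m' by apply: succn_inj; rewrite -km.
have : Num.sg (char_poly (B 2))`_1 = Num.sg (char_poly (B 2^-1))`_1.
  by rewrite Bm Bm' mm'.
rewrite !B1 !sgrM [Num.sg (1 - 2)]ltr0_sg; last by lra.
rewrite [Num.sg (1 - _)]gtr0_sg; last by lra.
(* This nonzero common factor would equal its own opposite, as [1 - t] changes sign between [2] and
   [2^-1]. *)
have : Num.sg ((-1) ^+ n.-1 : R) * Num.sg c != 0.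
  by rewrite mulf_neq0 ?sgr_eq0 ?signr_eq0.
move=> /eqP h1 h2; lra.
Qed.
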